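(* Let $R$ be a finite principal ideal ring (not necessarily commutative), let $\mu$ be the Möbius function of the lattice $L^*$ of all right ideals of $R$ (ordered by inclusion), and let $w: R \to \mathbb{Q}$ be a bi-invariant weight on $R$ with $w(0)=0$. Then $w$ satisfies the Extension Property if and only if $$\sum_{0 \ne dR \le aR} w(d)\, \mu(0, dR) \;\neq\; 0 \quad \text{for every nonzero right ideal } aR \text{ of } R,$$ where the sum runs over all nonzero right ideals $dR$ contained in $aR$ (each ideal counted once, with $d$ any generator of it).
   Context: All rings are finite, associative, with identity $1$, not necessarily commutative; modules are unital. $R^\times$ is the group of units of $R$. A principal ideal ring is a ring in which every left ideal is of the form $Rx$ and every right ideal is of the form $xR$. A weight on $R$ is any function $w: R \to \mathbb{Q}$; it is extended to $R^n$ by $w(x)=\sum_{i=1}^n w(x_i)$. It is bi-invariant if $w(ux)=w(x)=w(xu)$ for all $x\in R$, $u\in R^\times$. In a finite ring $dR=d'R$ holds iff $d' \in dR^\times$, so $w(d)$ depends only on the right ideal $dR$ when $w$ is bi-invariant. The right symmetry group of $w$ is $G_{\mathrm{rt}}(w)=\{v\in R^\times : w(xv)=w(x) \text{ for all } x\in R\}$ (which equals $R^\times$ for bi-invariant $w$). A linear code of length $n$ is a left submodule $C\le {}_RR^n$. A $w$-isometry is a left $R$-linear map $\varphi: C\to {}_RR^n$ with $w(\varphi(x))=w(x)$ for all $x\in C$. A $G_{\mathrm{rt}}(w)$-monomial transformation of $R^n$ is a map $\Phi(x_1,\dots,x_n)=(x_{\pi(1)}u_1,\dots,x_{\pi(n)}u_n)$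 with $\pi\in S_n$ and $u_1,\dots,u_n\in G_{\mathrm{rt}}(w)$. $R$ and $w$ satisfy the Extension Property if for every $n\ge 1$ and every linear code $C\le {}_RR^n$, every injective $w$-isometry $\varphi: C\to {}_RR^n$ is the restriction to $C$ of a $G_{\mathrm{rt}}(w)$-monomial transformation of $R^n$. The Möbius function $\mu$ of a finite poset $P$ is defined by $\mu(x,x)=1$, $\sum_{x\le t\le y}\mu(x,t)=0$ for $x<y$, and $\mu(x,y)=0$ if $x\not\le y$. *)

(* Defs.v *)
From HB Require Import structures.
From mathcomp Require Import all_boot all_order all_fingroup all_algebra.

Set Implicit Arguments.
Unset Strict Implicit.
Unset Printing Implicit Defensive.

Import Order.TTheory GRing.Theory Num.Theory.

Local Open Scope ring_scope.

(* The recursion is on fuel bounding the length of chains in [x, y]; #|T|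
   always suffices, see mobius_sum. *)
Section Mobius.
Variables (disp : Order.disp_t) (T : finPOrderType disp).

Fixpoint mobius_rec (n : nat) (x y : T) : int :=
  if x == y then 1
  else if n is m.+1 then
    if (x < y)%O then - \sum_(t : T | (x <= t < y)%O) mobius_rec m x t else 0
  else 0.

Definition mobius (x y : T) : int := mobius_rec #|T| x y.

Lemma mobius_rec_fuel n m x y :
  (#|[pred t : T | (x <= t < y)%O]| <= n)%N ->
  (#|[pred t : T | (x <= t < y)%O]| <= m)%N -> mobius_rec n x y = mobius_rec m x y.
Proof.
elim: n m y => [|n IHn] [|m] y //=; rewrite ?leqn0.
- move=> /eqP/card0_eq e _; case: eqVneq => // _; case: ifP => // lxy.
  by have := e x; rewrite !inE lexx lxy.
- move=> _ /eqP/card0_eq e; case: eqVneq => // _; case: ifP => // lxy.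
  by have := e x; rewrite !inE lexx lxy.
move=> hn hm; case: eqVneq => // _; case: ifP => // lxy; congr (- _).
apply: eq_bigr => t /andP[lxt lty].
have lt_card : (#|[pred s : T | (x <= s < t)%O]| <
                #|[pred s : T | (x <= s < y)%O]|)%N.
  apply/proper_card/properP; split.
    by apply/subsetP => s; rewrite !inE => /andP[-> /lt_trans]; apply.
  by exists t; rewrite !inE ?ltxx ?andbF // lxt.
apply: IHn; rewrite -ltnS; exact: leq_trans lt_card _.
Qed.

Lemma mobius_id x : mobius x x = 1.
Proof. by rewrite /mobius; case: #|T| => [|n] /=; rewrite eqxx. Qed.

Lemma mobius_nle x y : ~~ (x <= y)%O -> mobius x y = 0.
Proof.
move=> nxy; have nexy : x != y by apply: contraNneq nxy => ->.
rewrite /mobius; case: #|T| => [|n] /=; rewrite (negPf nexy) //.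
by rewrite lt_neqAle (negPf nxy) andbF.
Qed.

Lemma mobius_sum x y :
  (x < y)%O -> \sum_(t : T | (x <= t <= y)%O) mobius x t = 0.
Proof.
move=> lxy; have lexy := ltW lxy; rewrite (bigD1 y) /=; last by rewrite lexy lexx.
have mE : mobius x y = - \sum_(t : T | (x <= t < y)%O) mobius x t.
  have /= := @mobius_rec_fuel #|T| #|T|.+1 x y (max_card _)
    (leqW (max_card _)).
  by rewrite /mobius => ->; rewrite lt_eqF // lxy.
apply/eqP; rewrite mE addrC subr_eq0; apply/eqP/eq_bigl => t.
by rewrite lt_neqAle -andbA; congr (_ && _); rewrite andbC.
Qed.

End Mobius.

Section Ideals.
Variable R : finPzRingType.

(* GRing.unit is only available on nontrivial rings; the zero ring is allowed
   here, so the unit group is spelled out. *)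
Definition unit_set : {set R} :=
  [set u | [exists v : R, (v * u == 1) && (u * v == 1)]].

(* Closure under opposites follows, since -x = x * (-1). *)
Definition is_right_ideal (I : {set R}) : bool :=
  [&& 0 \in I, [forall x in I, forall y in I, x + y \in I]
    & [forall x in I, forall r : R, x * r \in I]].

Definition is_left_ideal (I : {set R}) : bool :=
  [&& 0 \in I, [forall x in I, forall y in I, x + y \in I]
    & [forall x in I, forall r : R, r * x \in I]].

Definition principal_ring : Prop :=
  (forall I : {set R}, is_left_ideal I -> exists x, I = [set r * x | r : R]) /\
  (forall I : {set R}, is_right_ideal I -> exists x, I = [set x * r | r : R]).

Record right_ideal := RightIdeal {
  right_ideal_set :> {set R};
  _ : is_right_ideal right_ideal_set
}.

HB.instance Definition _ := [isSub for right_ideal_set].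
HB.instance Definition _ := [Finite of right_ideal by <:].

Definition right_ideal_le (I J : right_ideal) : bool := I \subset J.

Fact right_ideal_le_refl : reflexive right_ideal_le.
Proof. by move=> I; apply: subxx. Qed.

Fact right_ideal_le_anti : antisymmetric right_ideal_le.
Proof. by move=> I J /= leIJ; apply/val_inj/eqP; rewrite eqEsubset. Qed.

Fact right_ideal_le_trans : transitive right_ideal_le.
Proof. by move=> J I K; apply: subset_trans. Qed.

Fact right_ideal_display : Order.disp_t. Proof. exact: Order.Disp tt tt. Qed.

HB.instance Definition _ := Order.Le_isPOrder.Build right_ideal_display
  right_ideal right_ideal_le_refl right_ideal_le_anti right_ideal_le_trans.

Lemma right_ideal_leE (I J : right_ideal) : (I <= J)%O = (I \subset J).
Proof. by []. Qed.

Fact principal_right_idealP (a : R) : is_right_ideal [set a * r | r : R].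
Proof.
apply/and3P; split; first by apply/imsetP; exists 0; rewrite ?mulr0.
  apply/forall_inP => _ /imsetP[r _ ->]; apply/forall_inP => _ /imsetP[s _ ->].
  by apply/imsetP; exists (r + s); rewrite ?mulrDr.
apply/forall_inP => _ /imsetP[r _ ->]; apply/forallP => s.
by apply/imsetP; exists (r * s); rewrite ?mulrA.
Qed.

Definition principal_right_ideal (a : R) : right_ideal :=
  RightIdeal (principal_right_idealP a).

Definition zero_right_ideal : right_ideal := principal_right_ideal 0.

Lemma zero_right_idealE : zero_right_ideal = [set 0] :> {set R}.
Proof.
apply/setP => x; rewrite inE; apply/imsetP/eqP => [[r _ ->]|->].
  by rewrite mul0r.
by exists 0; rewrite ?mul0r.
Qed.

Definition generator_choice (gen : right_ideal -> R) : Prop :=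
  forall I, principal_right_ideal (gen I) = I.

Lemma generator_choice_exists :
  principal_ring -> exists gen, generator_choice gen.
Proof.
case=> _ pir; have ex I : exists x : R, principal_right_ideal x == I.
  have [x Ex] := pir _ (valP I).
  by exists x; apply/eqP/val_inj; rewrite /= -Ex.
by exists (fun I => xchoose (ex I)) => I; apply/eqP/(xchooseP (ex I)).
Qed.

End Ideals.

Lemma unit_setE (R : finUnitRingType) : unit_set R =i GRing.unit.
Proof.
move=> u; rewrite inE; apply/existsP/idP => [[v /andP[/eqP vu /eqP uv]]|uU].
  by apply/unitrP; exists v.
by exists u^-1; rewrite mulVr ?mulrV ?eqxx.
Qed.

Section Weights.
Variables (R : finPzRingType) (w : R -> rat).

Definition bi_invariant : Prop :=
  forall u x : R, u \in unit_set R -> w (u * x) = w x /\ w (x * u) = w x.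

Definition weight n (x : 'rV[R]_n) : rat := \sum_(i < n) w (x 0 i).

Definition right_symmetry_group : {set R} :=
  [set v in unit_set R | [forall x : R, w (x * v) == w x]].

Definition monomial_map n (p : 'S_n) (u : 'I_n -> R) (x : 'rV[R]_n) : 'rV[R]_n :=
  \row_i (x 0 (p i) * u i).

(* The map C -> R^n is represented by a total function, only ever used on C. *)
Definition linear_on n (C : {set 'rV[R]_n}) (f : 'rV[R]_n -> 'rV[R]_n) : Prop :=
  forall a : R, {in C &, forall x y, f (a *: x + y) = a *: f x + f y}.

Definition isometry_on n (C : {set 'rV[R]_n}) (f : 'rV[R]_n -> 'rV[R]_n) : Prop :=
  linear_on C f /\ {in C, forall x, weight (f x) = weight x}.

Definition extension_property : Prop :=
  forall (n : nat) (C : {set 'rV[R]_n}) (f : 'rV[R]_n -> 'rV[R]_n),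
    (1 <= n)%N -> submod_closed C -> isometry_on C f -> {in C &, injective f} ->
    exists (p : 'S_n) (u : 'I_n -> R),
      (forall i, u i \in right_symmetry_group) /\
      {in C, f =1 monomial_map p u}.

End Weights.

(* Main.v *)
(** Coordinates of a code C and of its image under an isometry are left linear
    maps C -> R, so extension amounts to the injectivity of the incidence of
    orbits of such maps through w.

    Let W be the matrix w(r d), for r in R and dR a right ideal.  In a finite
    principal ideal ring every right ideal K is the right annihilator of some r,
    and r determines K up to a left unit.  Multiplying W by the Moebius matrix
    mu(K, dR) gives a matrix that vanishes unless ann(r) <= K (Weisner's
    argument) and whose entry at K = ann(r) is the sum of the theorem for rR,
    because dR |-> rdR maps the interval above ann(r) onto the one below rR.  So
    W has independent columns on nonzero right ideals iff all those sums are
    nonzero.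

    If a sum vanishes, an integral dependency between the columns of W yields
    two vectors x, y over R such that r x |-> r y is an isometry that is not
    monomial.  If none vanishes, an isometry preserves, for each codeword, the
    number of coordinates generating each right ideal; a function k with
    k(0) = 1 and zero sum on each nonzero left ideal then plays the part of a
    generating character: summing k(l(x) u - nu(x)) over the codewords x
    detects whether l u = nu.

    That a right ideal is an annihilator follows by counting: |l(K)| |K| <= |R|
    holds for K maximal, because the socle component of R of type R/K is cyclic,
    and then for all K by induction; the two one-sided versions force
    equality. *)

Require Import Defs.
From HB Require Import structures.
From mathcomp Require Import all_boot all_order all_fingroup all_algebra.
Import Order.TTheory GRing.Theory Num.Theory.
Local Open Scope ring_scope.

Set Implicit Arguments.
Unset Strict Implicit.
Unset Printing Implicit Defensive.

(** * Moebius inversion on finite posets *)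

Section Poset.
Variables (disp : Order.disp_t) (T : finPOrderType disp).

Lemma lt_ind (P : T -> Prop) :
  (forall y, (forall t, (t < y)%O -> P t) -> P y) -> forall y, P y.
Proof.
move=> step y; have [n] := ubnP #|[pred t : T | (t < y)%O]|.
elim: n y => // n IHn y lt_n; apply: step => t lt_ty; apply: IHn.
rewrite -ltnS; apply: leq_trans lt_n; rewrite ltnS; apply/proper_card/properP.
split; first by apply/subsetP => s; rewrite !inE => /lt_trans; apply.
by exists t; rewrite !inE ?ltxx.
Qed.

Lemma gt_ind (P : T -> Prop) :
  (forall y, (forall t, (y < t)%O -> P t) -> P y) -> forall y, P y.
Proof.
move=> step y; have [n] := ubnP #|[pred t : T | (y < t)%O]|.
elim: n y => // n IHn y lt_n; apply: step => t lt_ty; apply: IHn.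
rewrite -ltnS; apply: leq_trans lt_n; rewrite ltnS; apply/proper_card/properP.
split; first by apply/subsetP => s; rewrite !inE; apply: lt_trans.
by exists t; rewrite !inE ?ltxx.
Qed.

(** Induction along [<]: the terms strictly below [y] cancel. Functions on a poset are identified
    below through their sums over down-sets. *)
Lemma sum_le_inj (V : zmodType) (F G : T -> V) :
    (forall y, \sum_(t | (t <= y)%O) F t = \sum_(t | (t <= y)%O) G t) ->
  F =1 G.
Proof.
move=> eqFG; apply: lt_ind => y IHy; have := eqFG y.
rewrite (bigD1 y) //= [in RHS](bigD1 y) //=.
rewrite [X in _ + X = _](eq_bigr G) => [/addIr //|t].
by rewrite andbC -lt_neqAle; apply: IHy.
Qed.

Lemma mobius_sumE (x y : T) :
  \sum_(t | (x <= t)%O && (t <= y)%O) mobius x t = (x == y)%:R.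
Proof.
have [<-|nexy] := eqVneq x y.
  rewrite (big_pred1 x) ?mobius_id // => t /=.
  by rewrite eq_sym eq_le.
have [lexy|nlexy] := boolP (x <= y)%O.
  by rewrite mobius_sum // lt_neqAle nexy.
by rewrite big_pred0 // => t; apply: contraNF nlexy => /andP[]; apply: le_trans.
Qed.

Lemma mobius_transform_sum (b : T -> rat) y :
  \sum_(t | (t <= y)%O) \sum_(x | (x <= t)%O) b x * (mobius x t)%:~R = b y.
Proof.
rewrite (exchange_big_dep (fun x => (x <= y)%O)) /=; last first.
  by move=> t x lety /le_trans; apply.
rewrite (bigD1 y) //= [X in _ + X]big1 ?addr0 => [|x /andP[_ nexy]].
  rewrite (big_pred1 y) => [|t]; last by rewrite /= eq_le.
  by rewrite mobius_id mulr1.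
rewrite -mulr_sumr -rmorph_sum (eq_bigl (fun t => (x <= t)%O && (t <= y)%O)).
  by rewrite /= mobius_sumE (negPf nexy) mulr0.
by move=> t; rewrite andbC.
Qed.

End Poset.

(** * Right ideals of a finite ring *)

Section RightIdeals.
Variable R : finPzRingType.
Implicit Types (a b c d r s u x y z : R) (D E I K : right_ideal R).
Local Notation pr := (@principal_right_ideal R).

Lemma in_right_ideal0 I : 0 \in I.
Proof. by case: I => I /= /and3P[]. Qed.

Lemma in_right_idealD I x y : x \in I -> y \in I -> x + y \in I.
Proof. by case: I => I /= /and3P[_ /forall_inP h _] /h/forall_inP; apply. Qed.

Lemma in_right_idealM I x r : x \in I -> x * r \in I.
Proof. by case: I => I /= /and3P[_ _ /forall_inP h] /h/forallP; apply. Qed.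

Lemma in_right_idealB I x y : x \in I -> y \in I -> x - y \in I.
Proof.
by move=> Ix Iy; rewrite -[y]mulr1 -mulrN in_right_idealD ?in_right_idealM.
Qed.

Lemma is_right_idealP (A : {set R}) :
    0 \in A -> {in A &, forall x y, x + y \in A} ->
  (forall x r, x \in A -> x * r \in A) -> is_right_ideal A.
Proof.
move=> A0 AD AM; apply/and3P; split=> //.
  by apply/forall_inP => x Ax; apply/forall_inP => y; apply: AD.
by apply/forall_inP => x Ax; apply/forallP => r; apply: AM.
Qed.

Lemma right_idealP D E : D =i E -> D = E.
Proof. by move=> eqDE; apply/val_inj/setP. Qed.

Lemma mem_principalP a x : reflect (exists r, x = a * r) (x \in pr a).
Proof. by apply: (iffP imsetP) => -[r]; [exists r | exists r]. Qed.

Lemma mem_principal a : a \in pr a.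
Proof. by apply/mem_principalP; exists 1; rewrite mulr1. Qed.

Lemma principal_le a D : (pr a <= D)%O = (a \in D).
Proof.
rewrite right_ideal_leE; apply/subsetP/idP => [-> //|Da x].
  exact: mem_principal.
by case/mem_principalP=> r ->; apply: in_right_idealM.
Qed.

Lemma principal1_top D : (D <= pr 1)%O.
Proof.
by apply/subsetP => x _; apply/mem_principalP; exists x; rewrite mul1r.
Qed.

Lemma zero_ideal_le D : (zero_right_ideal R <= D)%O.
Proof. by rewrite principal_le in_right_ideal0. Qed.

Lemma mem_zero_ideal x : (x \in zero_right_ideal R) = (x == 0).
Proof. by rewrite zero_right_idealE inE. Qed.

Lemma principal_eq0 a : (pr a == zero_right_ideal R) = (a == 0).
Proof.
by rewrite eq_le zero_ideal_le andbT principal_le mem_zero_ideal.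
Qed.

Fact preimage_right_idealP r E : is_right_ideal [set s | r * s \in E].
Proof.
apply: is_right_idealP => [|x y|x s]; rewrite !inE ?mulr0 ?in_right_ideal0 //.
  by rewrite mulrDr; apply: in_right_idealD.
by rewrite mulrA; apply: in_right_idealM.
Qed.

Definition preimage_right_ideal r E := RightIdeal (preimage_right_idealP r E).

Lemma mem_preimage r E s : (s \in preimage_right_ideal r E) = (r * s \in E).
Proof. by rewrite inE. Qed.

Definition right_annihilator r := preimage_right_ideal r (zero_right_ideal R).

Lemma mem_right_annihilator r s : (s \in right_annihilator r) = (r * s == 0).
Proof. by rewrite mem_preimage mem_zero_ideal. Qed.

Fact cap_right_idealP D E : is_right_ideal (D :&: E).
Proof.
apply: is_right_idealP => [|x y|x s]; rewrite !inE ?in_right_ideal0 //.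
  by move=> /andP[? ?] /andP[? ?]; rewrite !in_right_idealD.
by move=> /andP[? ?]; rewrite !in_right_idealM.
Qed.

Definition cap_right_ideal D E := RightIdeal (cap_right_idealP D E).

Lemma mem_cap D E x : (x \in cap_right_ideal D E) = (x \in D) && (x \in E).
Proof. by rewrite inE. Qed.

Fact add_right_idealP D E : is_right_ideal [set x + y | x in D, y in E].
Proof.
apply: is_right_idealP => [|x y|x s].
- by apply/imset2P; exists 0 0; rewrite ?in_right_ideal0 ?addr0.
- case/imset2P=> x1 x2 D1 E2 -> /imset2P[y1 y2 D3 E4 ->].
  by rewrite addrACA; apply: imset2_f; apply: in_right_idealD.
case/imset2P=> x1 x2 D1 E2 ->.
by rewrite mulrDl; apply: imset2_f; apply: in_right_idealM.
Qed.

Definition add_right_ideal D E := RightIdeal (add_right_idealP D E).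

Lemma mem_addP D E z :
  reflect (exists2 x, x \in D & z - x \in E) (z \in add_right_ideal D E).
Proof.
apply: (iffP imset2P) => [[x y Dx Ey ->]|[x Dx Ezx]].
  by exists x; rewrite // addrC addKr.
by exists x (z - x); rewrite // addrC subrK.
Qed.

Lemma add_le_l D E : (D <= add_right_ideal D E)%O.
Proof.
apply/subsetP => x Dx; apply/mem_addP.
by exists x; rewrite ?subrr ?in_right_ideal0.
Qed.

Lemma add_le_r D E : (E <= add_right_ideal D E)%O.
Proof.
apply/subsetP => x Ex; apply/mem_addP.
by exists 0; rewrite ?subr0 ?in_right_ideal0.
Qed.

(** Adding [u0 * t - u0], for one fixed solution [u0], carries solutions of [a * u = x] to solutions
    of [a * u = x * t]. *)
Lemma fixing_card_le x t E a :
  (#|[set u in E | (a * u)%R == x]| <= #|[set u in E | a * u == x * t]%R|)%N.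
Proof.
have [->|[u0 /setIdP[Eu0 /eqP au0]]] := set_0Vmem [set u in E | a * u == x].
  by rewrite cards0.
rewrite -(card_imset _ (addIr (u0 * t - u0))); apply/subset_leq_card.
apply/subsetP => _ /imsetP[u /setIdP[Eu /eqP au] ->].
rewrite inE in_right_idealD ?in_right_idealB ?in_right_idealM //=.
by rewrite mulrDr mulrBr mulrA au0 au addrC subrK.
Qed.

(* The number of u generating E with a * u = x is the same for x = a and for
   x = b, because this holds for the number of u in E with a * u = x. *)
Lemma principal_unit a b :
  pr a = pr b -> exists2 u, u \in unit_set R & b = a * u.
Proof.
move=> eqab.
have /mem_principalP[t bE] : b \in pr a by rewrite eqab mem_principal.
have /mem_principalP[s aE] : a \in pr b by rewrite -eqab mem_principal.
pose N x D : int := \sum_(u | (a * u == x) && (pr u == D)) 1.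
have NE x E : \sum_(D | (D <= E)%O) N x D = #|[set u in E | a * u == x]|%:R.
  rewrite -sum1_card natr_sum.
  rewrite (partition_big pr (fun D => (D <= E)%O)) => [|u]; last first.
    by rewrite inE principal_le => /andP[].
  apply: eq_bigr => D leDE; apply: eq_bigl => u; rewrite inE.
  by case: (pr u =P D) => [uD|]; rewrite ?andbF ?andbT // -principal_le uD leDE.
have eqN : N a =1 N b.
  apply: sum_le_inj => E; rewrite !NE; congr _%:R; apply/eqP.
  by rewrite eqn_leq; apply/andP; split;
    [rewrite bE | rewrite {3}aE]; apply: fixing_card_le.
(* The element [1] is counted by [N a (pr 1)], so [N b (pr 1)] is nonzero as well. *)
have [u /andP[/eqP <- /eqP u1]] : exists u, (a * u == b) && (pr u == pr 1).
  apply/existsP; have := eqN (pr 1); apply: contra_eqT.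
  rewrite negb_exists => /forallP no; rewrite [N b _]big_pred0; last first.
    by move=> u; apply/negbTE/no.
  rewrite /N sumr_const pnatr_eq0 -lt0n; apply/card_gt0P; exists 1.
  by rewrite unfold_in mulr1 !eqxx.
exists u => //.
have /mem_principalP[v uv] : 1 \in pr u by rewrite u1 mem_principal.
(* By finiteness the right inverse [v] of [u] has itself a right inverse, which must be [u]. *)
have inj_v : injective (fun x => v * x).
  by move=> x y /(congr1 (fun x => u * x)); rewrite !mulrA -uv !mul1r.
have [x vx] : exists x, v * x = 1.
  by exists (invF inj_v 1); apply: (f_invF inj_v).
have ux : u = x by rewrite -[u]mulr1 -vx mulrA -uv mul1r.
by rewrite inE; apply/existsP; exists v; rewrite ux vx -ux -uv !eqxx.
Qed.

Lemma principal_mulr_unit a u : u \in unit_set R -> pr (a * u) = pr a.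
Proof.
rewrite inE => /existsP[v /andP[_ /eqP uv]].
apply/le_anti; rewrite !principal_le; apply/andP; split; apply/mem_principalP.
  by exists u.
by exists v; rewrite -mulrA uv mulr1.
Qed.

End RightIdeals.

(** * One-sided counting of annihilators *)

Section AdditiveCounting.
Variables (V U : finZmodType) (G : {set V}) (g : V -> U).
Hypotheses (G0 : 0 \in G) (GB : {in G &, forall x y, x - y \in G}).
Hypothesis gB : {in G &, forall x y, g (x - y) = g x - g y}.

(** The fibres of [g] over its image are translates of its kernel. *)
Lemma sum_additive (F : U -> rat) :
  \sum_(x in G) F (g x) =
  #|[set x in G | g x == 0]|%:R * \sum_(y in g @: G) F y.
Proof.
have GN x : x \in G -> - x \in G by move=> Gx; rewrite -sub0r GB.
have GD x y : x \in G -> y \in G -> x + y \in G.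
  by move=> Gx Gy; rewrite -[y]opprK GB ?GN.
have gD x y : x \in G -> y \in G -> g (x + y) = g x + g y.
  move=> Gx Gy; apply/eqP; rewrite -subr_eq -gB ?GD //.
  by rewrite addrK.
rewrite mulr_sumr (partition_big_imset g);
  apply: eq_bigr => _ /imsetP[x0 Gx0 ->].
rewrite (eq_bigr (fun=> F (g x0))) => [|x /andP[_ /eqP-> //]].
rewrite sumr_const mulr_natl; congr (_ *+ _).
rewrite -[RHS](card_imset _ (addIr x0)); apply: eq_card => x;
  rewrite [LHS]unfold_in.
apply/andP/imsetP => [[Gx /eqP gx]|[y /setIdP[Gy /eqP gy] ->]].
  by exists (x - x0); rewrite ?subrK // inE GB //= gB // gx subrr.
by rewrite GD // gD // gy add0r.
Qed.

Lemma card_additive : #|G| = (#|[set x in G | g x == 0%R]| * #|g @: G|)%N.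
Proof.
have := sum_additive (fun=> 1); rewrite !sumr_const -natrM => /eqP.
by rewrite eqr_nat => /eqP.
Qed.

End AdditiveCounting.

Section RightPrincipal.
Variable R : finPzRingType.
Hypothesis pirR : forall I : {set R},
  is_right_ideal I -> exists x, I = [set x * r | r : R].
Implicit Types (a b c d r s u x y z : R) (D E I K P : right_ideal R).
Local Notation pr := (@principal_right_ideal R).

Lemma right_ideal_principal I : exists x, I = pr x.
Proof.
by have [x Ex] := pirR (valP I); exists x; apply/val_inj; rewrite /= -Ex.
Qed.

(* A rational substitute for a generating character of R: the Moebius function
   of the lattice, spread evenly over the generators of each ideal. *)
Lemma sum_zero_function : exists2 k : R -> rat, k 0 = 1 &
  forall I, I != zero_right_ideal R -> \sum_(y in I) k y = 0.
Proof.
pose k y : rat :=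
  (mobius (zero_right_ideal R) (pr y))%:~R / #|[set z | pr z == pr y]|%:R.
exists k => [|I nzI].
  rewrite /k mobius_id (_ : [set z | _] = [set 0]) ?cards1 ?divr1 //.
  by apply/setP => z; rewrite !inE principal_eq0.
rewrite (partition_big pr (fun D => (D <= I)%O)) => [|y Iy]; last first.
  by rewrite principal_le.
transitivity (\sum_(D | (D <= I)%O) (mobius (zero_right_ideal R) D)%:~R : rat).
  apply: eq_bigr => D leDI; have [d Dd] := right_ideal_principal D.
  transitivity (\sum_(y in [set z | pr z == pr d]) k d).
    apply: congr_big => // y; last first.
      by move/andP=> [_ /eqP yD]; rewrite /k yD Dd.
    by rewrite inE Dd; case: eqP => [yd|];
      rewrite ?andbF // -principal_le yd -Dd leDI.
  rewrite sumr_const -[k d *+ _]mulr_natr /k -mulrA mulVf ?mulr1 ?Dd //.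
  by rewrite pnatr_eq0 -lt0n; apply/card_gt0P; exists d; rewrite inE.
rewrite -[LHS]rmorph_sum /=.
rewrite (eq_bigl (fun D => (zero_right_ideal R <= D)%O && (D <= I)%O)).
  by rewrite mobius_sumE eq_sym (negPf nzI).
by move=> D; rewrite zero_ideal_le.
Qed.

Definition left_annihilator (K : {set R}) : {set R} :=
  [set x | [forall y in K, x * y == 0]].

Lemma left_annihilatorP (K : {set R}) x :
  reflect (forall y, y \in K -> x * y = 0) (x \in left_annihilator K).
Proof.
rewrite inE; apply: (iffP forall_inP) => h y Ky; apply/eqP/h => //.
Qed.

Lemma left_annihilator_principal d :
  left_annihilator (pr d) = [set x | x * d == 0].
Proof.
apply/setP => x; rewrite [RHS]inE; apply/left_annihilatorP/eqP => [->//|xd y].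
  exact: mem_principal.
by case/mem_principalP=> r ->; rewrite mulrA xd mul0r.
Qed.

Lemma left_annihilator0 (K : {set R}) : 0 \in left_annihilator K.
Proof. by apply/left_annihilatorP => y _; rewrite mul0r. Qed.

Lemma left_annihilatorB (K : {set R}) :
  {in left_annihilator K &, forall x y, x - y \in left_annihilator K}.
Proof.
move=> x y /left_annihilatorP lx /left_annihilatorP ly.
by apply/left_annihilatorP => s Ks; rewrite mulrBl lx ?ly ?subr0.
Qed.

(** * Annihilators of maximal right ideals *)

Section MaximalRightIdeal.
Variable P : right_ideal R.
Hypotheses (P1 : 1 \notin P).
Hypothesis Pmax : forall s, s \notin P -> exists q, 1 - s * q \in P.
Local Notation lP := (left_annihilator P).

(** [Pmax] makes [R/P] simple, so a nonzero [f] in [lP] has right annihilator exactly [P], and [fR]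
    is a copy of [R/P]. *)
Lemma maximal_annihilator f s : f \in lP -> f != 0 -> (f * s == 0) = (s \in P).
Proof.
move=> /left_annihilatorP lf nzf; apply/eqP/idP => [fs|/lf //].
apply: contraNT nzf => /Pmax[q /lf]; rewrite mulrBr mulr1 mulrA fs mul0r subr0.
by move->.
Qed.

(** [fR] is simple or zero, so it meets trivially any right ideal not containing [f]. *)
Lemma maximal_disjoint f s I :
  f \in lP -> f \notin I -> f * s \in I -> f * s = 0.
Proof.
move=> /left_annihilatorP lf nfI fsI; apply/eqP; apply: contraNT nfI => nzfs.
have /Pmax[q /lf/eqP] : s \notin P by apply: contraNN nzfs => /lf->.
rewrite mulrBr mulr1 mulrA subr_eq0 => /eqP->; exact: in_right_idealM.
Qed.

Lemma card_principal f :
  f \in lP -> f != 0 -> #|R| = (#|P| * #|pr f|)%N.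
Proof.
move=> lf nzf; rewrite -cardsT (@card_additive _ _ [set: R] ( *%R f)) ?inE //.
- congr (_ * _)%N; apply: eq_card => s;
    first by rewrite !inE maximal_annihilator.
  by apply/imsetP/mem_principalP => [[x _ ->]|[x ->]]; exists x.
- by move=> x y _ _; rewrite inE.
- by move=> x y _ _; rewrite mulrBr.
Qed.

(** With [E] the idealizer of [P], left multiplication by [h] maps [E] onto [lP :&: pr h] with
    kernel [E :&: P], whatever [h] is; the common size is that of the endomorphism ring of [R/P]. *)
Lemma card_annihilator_principal f g :
    f \in lP -> f != 0 -> g \in lP -> g != 0 ->
  #|lP :&: pr f| = #|lP :&: pr g|.
Proof.
pose E := [set e | [forall p in P, e * p \in P]].
have PE e p : e \in E -> p \in P -> e * p \in P.
  by rewrite inE => /forall_inP; apply.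
have E0 : 0 \in E by rewrite inE; apply/forall_inP => p;
  rewrite mul0r in_right_ideal0.
have EB : {in E &, forall x y, x - y \in E}.
  move=> x y Ex Ey; rewrite inE; apply/forall_inP => p Pp.
  by rewrite mulrBl in_right_idealB ?PE.
have key h : h \in lP -> h != 0 -> #|E| = (#|E :&: P| * #|lP :&: pr h|)%N.
  move=> lh nzh; rewrite (@card_additive _ _ E ( *%R h)) //; last first.
    by move=> x y _ _; rewrite mulrBr.
  congr (_ * _)%N; apply: eq_card => s.
    by rewrite !inE maximal_annihilator.
  apply/imsetP/setIP => [[e Ee ->]|[/left_annihilatorP ls
    /mem_principalP[e se]]].
    split; last by apply/mem_principalP; exists e.
    apply/left_annihilatorP => p Pp; apply/eqP.
    by rewrite -mulrA maximal_annihilator ?PE.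
  exists e => //; rewrite inE; apply/forall_inP => p Pp.
  by rewrite -(maximal_annihilator _ lh nzh) mulrA -se ls.
move=> lf nzf lg nzg; have := key f lf nzf; rewrite (key g lg nzg).
move/eqP; rewrite eqn_pmul2l => [/eqP-> //|].
by apply/card_gt0P; exists 0; rewrite inE E0 in_right_ideal0.
Qed.

(** The possible images of [z] under homomorphisms from [zR] to [f0 R], so that its size counts
    these homomorphisms. *)
Let Y f0 z := [set c in pr f0 | [forall s, (z * s == 0) ==> (c * s == 0)]].

Lemma mem_YP f0 z c :
  reflect (c \in pr f0 /\ forall s, z * s = 0 -> c * s = 0) (c \in Y f0 z).
Proof.
rewrite inE; apply: (iffP andP) => -[Tc h]; split=> //.
  by move=> s zs; apply/eqP; have /forallP/(_ s) := h; rewrite zs eqxx.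
by apply/forallP => s; apply/implyP => /eqP/h->.
Qed.

(** Here [zR] is the direct sum of [z'R] and the simple [fR]. The left side grows at most by the
    factor [#|lP :&: pr f|], the right side at least by [#|lP :&: pr f0|], the number of
    homomorphisms from [fR] to [f0 R]; the two factors agree. *)
Lemma homogeneous_step f0 z' z f :
    f0 \in lP -> f0 != 0 -> f \in lP -> f \notin pr z' ->
    pr z = add_right_ideal (pr z') (pr f) ->
    (#|lP :&: pr z'| <= #|Y f0 z'|)%N ->
  (#|lP :&: pr z| <= #|Y f0 z|)%N.
Proof.
move=> lf0 nzf0 lf nfz' Ez IHz'.
have nzf : f != 0 by apply: contraNneq nfz' => ->; apply: in_right_ideal0.
have : z \in add_right_ideal (pr z') (pr f) by rewrite -Ez mem_principal.
case/mem_addP=> _ /mem_principalP[a ->] /mem_principalP[b /eqP].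
rewrite subr_eq addrC => /eqP zE.
have : z' \in pr z by rewrite Ez -principal_le add_le_l.
case/mem_principalP=> s1 z'E.
have : f \in pr z by rewrite Ez -principal_le add_le_r.
case/mem_principalP=> s2 fE.
(* As the sum is direct and [z = z' * a + f * b], the equations [z * s1 = z'] and [z * s2 = f] hold
   componentwise. *)
have fbs1 : f * (b * s1) = 0.
  apply: (maximal_disjoint lf nfz').
  have -> : f * (b * s1) = z' - z' * (a * s1).
    by apply/eqP; rewrite eq_sym subr_eq !mulrA addrC -mulrDl -zE -z'E.
  by rewrite in_right_idealB ?in_right_idealM ?mem_principal.
have z'as1 : z' * (1 - a * s1) = 0.
  apply/eqP; rewrite mulrBr mulr1 subr_eq0; apply/eqP.
  by rewrite {1}z'E zE mulrDl -!mulrA fbs1 addr0.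
have f1bs2 : f * (1 - b * s2) = 0.
  apply: (maximal_disjoint lf nfz').
  have -> : f * (1 - b * s2) = z' * (a * s2).
    apply/eqP; rewrite mulrBr mulr1 subr_eq !mulrA addrC.
    by rewrite addrC -mulrDl -zE -fE.
  by rewrite in_right_idealM ?mem_principal.
have z'as2 : z' * (a * s2) = 0.
  move/eqP: f1bs2; rewrite mulrBr mulr1 subr_eq0 => /eqP fb.
  move: fE; rewrite zE mulrDl -!mulrA -fb => /eqP.
  by rewrite -subr_eq subrr => /eqP.
have bs1 : b * s1 \in P by rewrite -(maximal_annihilator _ lf nzf) fbs1.
have bs2 : 1 - b * s2 \in P by rewrite -(maximal_annihilator _ lf nzf) f1bs2.
apply: (@leq_trans (#|Y f0 z'| * #|lP :&: pr f0|)).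
  rewrite -(card_annihilator_principal lf nzf lf0 nzf0).
  apply: leq_trans (leq_mul IHz' (leqnn _)); rewrite -cardsX.
  apply: leq_trans (leq_imset_card (fun t => t.1 + t.2) _).
  apply/subset_leq_card/subsetP => y /setIP[ly]; rewrite Ez.
  case/mem_addP=> x z'x fyx; have [e Ee] := mem_principalP _ _ fyx.
  have lyx : y - x \in lP.
    apply/left_annihilatorP => p Pp; rewrite Ee -mulrA.
    apply: (maximal_disjoint lf nfz'); rewrite mulrA -Ee mulrBl.
    by rewrite (left_annihilatorP _ _ ly) // sub0r -mulrN in_right_idealM.
  apply/imsetP; exists (x, y - x); last by rewrite addrC subrK.
  by rewrite in_setX !in_setI lyx fyx z'x -[x in x \in lP](subKr y)
    left_annihilatorB.
(* The homomorphism sending [z'] to [c] and [f] to [e] sends [z] to [c * a + e * b]; multiplying by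
   [s1] and [s2] recovers [c] and [e]. *)
rewrite -cardsX -(@card_in_imset _ _ (fun t => t.1 * a + t.2 * b)).
  apply/subset_leq_card/subsetP => _ /imsetP[[c e] /= + ->].
  rewrite in_setX => /andP[/mem_YP[Tc c0] /setIP[le Te]].
  apply/mem_YP; split=> [|s zs]; first by rewrite in_right_idealD
    ?in_right_idealM.
  have fbs : f * (b * s) = 0.
    apply: (maximal_disjoint lf nfz'); have -> : f * (b * s) = - (z' * (a * s)).
      by apply/eqP; rewrite -addr_eq0 !mulrA addrC -mulrDl -zE zs.
    by rewrite -mulrN in_right_idealM ?mem_principal.
  rewrite mulrDl -!mulrA c0; last first.
    by move: zs; rewrite zE mulrDl -!mulrA fbs addr0.
  rewrite add0r; apply: (left_annihilatorP _ _ le).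
  by rewrite -(maximal_annihilator _ lf nzf) fbs.
apply: (can_in_inj (g := fun y => (y * s1, y * s2))) => -[c e].
rewrite in_setX => /andP[/mem_YP[_ c0] /setIP[/left_annihilatorP le _]] /=.
rewrite !mulrDl -!mulrA (le _ bs1) addr0 (c0 _ z'as2) add0r.
congr (_, _); apply/eqP; rewrite eq_sym -subr_eq0 -[X in X - _]mulr1 -mulrBr.
  by rewrite c0.
by rewrite le.
Qed.

(** For a nonzero [f0] in [lP], it suffices that [lP] is no larger than [f0 R]. A right ideal
    [I = zR] of largest size with [#|lP :&: I| <= #|Y f0 z|] contains [lP], for otherwise
    [homogeneous_step] enlarges it, and [Y f0 z] lies in [f0 R]. *)
Lemma maximal_card_bound : (#|lP| * #|P| <= #|R|)%N.
Proof.
have [f0 /andP[lf0 nzf0]|lP0] := pickP [pred f in lP | f != 0]; last first.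
  rewrite -[X in (_ <= X)%N]mul1n leq_mul ?max_card //.
  rewrite -(cards1 (0 : R)); apply/subset_leq_card/subsetP => f lf.
  by have := lP0 f; rewrite /= lf => /negbFE/eqP->; rewrite inE.
rewrite (card_principal lf0 nzf0) mulnC leq_mul2l; apply/orP; right.
pose Q I := [forall z, (I == pr z) ==> (#|lP :&: pr z| <= #|Y f0 z|)%N].
have Q0 : Q (zero_right_ideal R).
  apply/forallP => z; apply/implyP; rewrite eq_sym principal_eq0 => /eqP->.
  apply: (@leq_trans 1); last first.
    apply/card_gt0P; exists 0; apply/mem_YP.
    by split=> [|s]; rewrite ?in_right_ideal0 ?mul0r.
  rewrite -(cards1 (0 : R)); apply/subset_leq_card/subsetP => x.
  by rewrite in_setI mem_zero_ideal inE => /andP[].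
have [I QI Imax] := arg_maxnP (fun I : right_ideal R => #|I|) Q0.
have [z' Iz'] := right_ideal_principal I.
have lPI : lP \subset I.
  apply/subsetP => f lf; apply: contraT => nIf.
  have [z Ez] := right_ideal_principal (add_right_ideal I (pr f)).
  have QJ : Q (add_right_ideal I (pr f)).
    apply/forallP => x; apply/implyP => /eqP Ex.
    apply: (homogeneous_step lf0 nzf0 lf (z' := z')); rewrite -?Iz' //.
    by have /forallP/(_ z') := QI; rewrite Iz' eqxx.
  have : (#|add_right_ideal I (pr f)| <= #|I|)%N := Imax _ QJ.
  rewrite leqNgt proper_card //.
  apply/properP; split; first exact: (add_le_l I (pr f)).
  by exists f; rewrite // -principal_le add_le_r.
have /forallP/(_ z')/implyP/(_ (introT eqP Iz')) := QI.
rewrite -Iz' (setIidPl lPI) => le_lP.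
apply: leq_trans le_lP _; apply/subset_leq_card/subsetP => c.
by case/mem_YP.
Qed.

End MaximalRightIdeal.

(** Induction from larger ideals. If [J = K + cR] is minimal above [K], then [J/K] is a copy of
    [R/P] with [P] maximal, and [x |-> x * c] maps the left annihilator of [K] into that of [P],
    with kernel in that of [J]. The bounds for [J] and [P] combine. *)
Lemma annihilator_card_bound K : (#|left_annihilator K| * #|K| <= #|R|)%N.
Proof.
elim/gt_ind: K => K IHK.
have [K1|K1] := boolP (1 \in K).
  rewrite -[X in (_ <= X)%N]mul1n leq_mul ?max_card //.
  rewrite -(cards1 (0 : R)); apply/subset_leq_card/subsetP => x.
  by move/left_annihilatorP/(_ 1 K1); rewrite mulr1 inE => ->.
pose J c := add_right_ideal K (pr c).
(* Least size of [J c] makes [J c] minimal above [K], hence [P] maximal. *)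
have [c nKc cmin] := arg_minnP (fun c => #|J c|) (K1 : [pred c | c \notin K] 1).
pose P := preimage_right_ideal c K.
have P1 : 1 \notin P by rewrite mem_preimage mulr1.
have Kcy y : y \in J c -> exists s, y - c * s \in K.
  case/mem_addP=> x Kx /mem_principalP[s E]; exists s.
  by rewrite -E subKr.
have Pmax s : s \notin P -> exists q, 1 - s * q \in P.
  rewrite mem_preimage => nPs.
  have eqJ : J (c * s) = J c.
    apply/val_inj/eqP; rewrite eqEcard cmin // andbT; apply/subsetP => y.
    case/mem_addP=> x Kx /mem_principalP[r E]; apply/mem_addP; exists x => //.
    by apply/mem_principalP; exists (s * r); rewrite mulrA.
  have : c \in J (c * s) by rewrite eqJ -principal_le add_le_r.
  case/mem_addP=> x Kx /mem_principalP[q E]; exists q.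
  by rewrite mem_preimage mulrBr mulr1 mulrA -E subKr.
have ltKJ : (K < J c)%O.
  rewrite lt_neqAle add_le_l andbT; apply: contraNneq nKc => ->.
  by rewrite -principal_le add_le_r.
have cardJ : (#|R| * #|K| <= #|J c| * #|P|)%N.
  (* A chosen coefficient of [c] in [y] modulo [K]; on [J c] the default [0] never arises. *)
  pose q y := odflt 0 [pick s | y - c * s \in K].
  have Kq y : y \in J c -> y - c * q y \in K.
    rewrite /q => /Kcy[s Ks]; case: pickP => [//|/(_ s)].
    by rewrite Ks.
  rewrite -cardsT -!cardsX.
  rewrite -(@card_in_imset _ _
    (fun t => (c * t.1 + t.2, t.1 - q (c * t.1 + t.2)))).
    apply/subset_leq_card/subsetP => _ /imsetP[[s x] /= + ->].
    rewrite !in_setX => /andP[_ Kx].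
    have Jy : c * s + x \in J c.
      by apply/mem_addP; exists x; rewrite // addrK; apply/mem_principalP;
        exists s.
    rewrite Jy mem_preimage mulrBr; have := in_right_idealB (Kq _ Jy) Kx.
    by rewrite addrAC addrK.
  move=> [s x] [s' x'] /= _ _ [Ey Es].
  have ss' : s = s' by move: Es; rewrite Ey => /addIr.
  by move: Ey; rewrite ss' => /addrI->.
have cardl : (#|left_annihilator K| <=
              #|left_annihilator (J c)| * #|left_annihilator P|)%N.
  rewrite (@card_additive _ _ (left_annihilator K) (fun x => x * c)).
  - apply: leq_mul; apply/subset_leq_card/subsetP => x.
      case/setIdP=> /left_annihilatorP lx /eqP xc; apply/left_annihilatorP => y.
      case/Kcy=> s Ks; rewrite -[y](subrK (c * s)) mulrDr lx // mulrA xc.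
      by rewrite mul0r addr0.
    case/imsetP=> y /left_annihilatorP ly ->; apply/left_annihilatorP => s.
    by rewrite mem_preimage -mulrA; apply: ly.
  - exact: left_annihilator0.
  - exact: left_annihilatorB.
  by move=> x y _ _; rewrite mulrBl.
have cardR : (0 < #|R|)%N by apply/card_gt0P; exists 0.
have P0 : (0 < #|P|)%N by apply/card_gt0P; exists 0; apply: in_right_ideal0.
rewrite -(leq_pmul2r P0).
apply: (@leq_trans (#|left_annihilator (J c)| * (#|left_annihilator P| * #|P|)
  * #|K|)).
  rewrite mulnAC [X in (_ <= X * _)%N]mulnA; apply: leq_mul => //.
  by apply: leq_mul.
apply: (@leq_trans (#|left_annihilator (J c)| * #|R| * #|K|)).
  by rewrite leq_mul // leq_mul // maximal_card_bound.
rewrite -mulnA; apply: leq_trans (leq_mul (leqnn _) cardJ) _.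
by rewrite mulnA leq_mul // IHK.
Qed.

End RightPrincipal.

(** * Annihilators in two-sided principal ideal rings *)

(** Makes the opposite ring finite, so that one-sided results transfer to the other side. *)
HB.instance Definition _ (R : finPzRingType) := Finite.copy R^c R.

Section Converse.
Variable R : finPzRingType.

Lemma principal_ring_converse : principal_ring R -> principal_ring R^c.
Proof. by case=> pl pr; split=> I; [exact (pr I) | exact (pl I)]. Qed.

Lemma unit_set_converse : unit_set R^c = unit_set R.
Proof.
apply/setP => u; rewrite !inE; apply: eq_existsb => v.
by rewrite andbC.
Qed.

End Converse.

Lemma card_mulr (R : finPzRingType) (d : R) :
  #|R| = (#|[set x | (x * d)%R == 0%R]| * #|[set (r * d)%R | r : R]|)%N.
Proof.
rewrite -cardsT (@card_additive _ _ [set: R] (fun x => x * d)) ?inE //.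
- congr (_ * _)%N; first by apply: eq_card => s; rewrite !inE.
  by apply: eq_card => s; apply/imsetP/imsetP => -[x _ ->]; exists x.
- by move=> x y _ _; rewrite inE.
- by move=> x y _ _; rewrite mulrBl.
Qed.

(** With [l] the left annihilator of [dR], compare [|l| |dR| <= |R|] with [|l| |Rd| = |R|]. *)
Lemma card_principal_le (R : finPzRingType) (d : R) :
  principal_ring R ->
  (#|principal_right_ideal d| <= #|[set (r * d)%R | r : R]|)%N.
Proof.
case=> _ pirR; have := annihilator_card_bound pirR (principal_right_ideal d).
rewrite left_annihilator_principal (card_mulr d) leq_pmul2l //.
by apply/card_gt0P; exists 0; rewrite inE mul0r.
Qed.

Section PrincipalRing.
Variable R : finPzRingType.
Hypothesis pirR : principal_ring R.
Implicit Types (a b d r u x y : R) (K : right_ideal R).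
Local Notation pr := (@principal_right_ideal R).

(** The ring and its opposite give the two inequalities. *)
Lemma card_principal_left d : #|[set r * d | r : R]| = #|pr d|.
Proof.
apply/eqP; rewrite eqn_leq card_principal_le // andbT.
exact: (@card_principal_le R^c d (principal_ring_converse pirR)).
Qed.

Lemma card_right_annihilator a : (#|right_annihilator a| * #|pr a|)%N = #|R|.
Proof.
rewrite (card_mulr (a : R^c)); congr (_ * _)%N.
by apply: eq_card => s; rewrite mem_right_annihilator inE.
Qed.

Lemma card_left_annihilator K : (#|left_annihilator K| * #|K|)%N = #|R|.
Proof.
have [d ->] := right_ideal_principal pirR.2 K.
by rewrite left_annihilator_principal -card_principal_left -card_mulr.
Qed.

(** Let [Ra] be the left annihilator of [K]. The right annihilator of [a] contains [K], and both
    have size [|R| / |Ra|] because [|Ra| = |aR|]. *)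
Lemma right_annihilator_surj K : exists a, right_annihilator a = K.
Proof.
have leftK : is_left_ideal (left_annihilator K).
  apply/and3P; split; first exact: left_annihilator0.
    apply/forall_inP => x Kx; apply/forall_inP => y Ky.
    by rewrite -[y]opprK left_annihilatorB // -sub0r left_annihilatorB
      ?left_annihilator0.
  apply/forall_inP => x /left_annihilatorP Kx; apply/forallP => r.
  by apply/left_annihilatorP => y Ky; rewrite -mulrA Kx ?mulr0.
have [a Ka] := pirR.1 _ leftK; exists a; apply/esym.
have cardK : #|right_annihilator a| = #|K|.
  apply/eqP; have pra : (0 < #|pr a|)%N.
    by apply/card_gt0P; exists a; apply: mem_principal.
  rewrite -(eqn_pmul2r pra) card_right_annihilator.
  by rewrite -(card_left_annihilator K) Ka card_principal_left mulnC.
apply/val_inj/eqP; rewrite eqEcard cardK leqnn andbT.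
apply/subsetP => s Ks; rewrite mem_right_annihilator; apply/eqP.
have : a \in left_annihilator K by rewrite Ka; apply/imsetP; exists 1;
  rewrite ?mul1r.
by move/left_annihilatorP; apply.
Qed.

Lemma left_annihilator_annihilator a :
  left_annihilator (right_annihilator a) = [set r * a | r : R].
Proof.
apply/esym/eqP; rewrite eqEcard; apply/andP; split.
  apply/subsetP => _ /imsetP[r _ ->]; apply/left_annihilatorP => s.
  by rewrite mem_right_annihilator -mulrA => /eqP->; rewrite mulr0.
rewrite card_principal_left.
have ra0 : (0 < #|right_annihilator a|)%N.
  by apply/card_gt0P; exists 0; apply: in_right_ideal0.
by rewrite -(leq_pmul2r ra0) card_left_annihilator mulnC card_right_annihilator.
Qed.

(** The double annihilator recovers [Ra], so [Ra = Rb], and [principal_unit] applies in the opposite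
    ring. *)
Lemma right_annihilator_unit a b :
  right_annihilator a = right_annihilator b ->
  exists2 u, u \in unit_set R & b = u * a.
Proof.
move=> eqab; have eqR : [set r * a | r : R] = [set r * b | r : R].
  by rewrite -!left_annihilator_annihilator eqab.
rewrite -unit_set_converse; apply: (@principal_unit R^c a b).
by apply/val_inj; apply: eqR.
Qed.

Lemma sum_zero_function_left : exists2 k : R -> rat, k 0 = 1 &
  forall L : {set R}, is_left_ideal L -> L != [set 0] -> \sum_(y in L) k y = 0.
Proof.
have [k k0 ksum] := sum_zero_function (principal_ring_converse pirR).2.
exists k => // L leftL nzL; apply: (ksum (@RightIdeal R^c L leftL)).
apply: contra nzL => /eqP/(congr1 (@right_ideal_set R^c)) eqL; apply/eqP.
exact: etrans eqL (zero_right_idealE R^c).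
Qed.

End PrincipalRing.

(** * The Moebius transform of a weight *)

Section MobiusTransform.
Variables (R : finPzRingType) (w : R -> rat) (gen : right_ideal R -> R).
Hypotheses (pirR : principal_ring R) (wbi : bi_invariant w) (w0 : w 0 = 0).
Hypothesis genP : generator_choice gen.
Implicit Types (a r s u x y : R) (D E K : right_ideal R).
Local Notation pr := (@principal_right_ideal R).
Local Notation rann := (@right_annihilator R).

Lemma weight_principal a b : pr a = pr b -> w a = w b.
Proof. by case/principal_unit=> u Uu ->; rewrite (wbi _ Uu).2. Qed.

Lemma weight_gen a : w (gen (pr a)) = w a.
Proof. by apply: weight_principal; rewrite genP. Qed.

(** The push-forward of [mobius K] along [D |-> rD]. *)
Definition pushed_mobius r K E : int :=
  \sum_(D | (K <= D)%O && (pr (r * gen D) == E)) mobius K D.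

Lemma le_preimage r D E :
  (D <= preimage_right_ideal r E)%O = (pr (r * gen D) <= E)%O.
Proof. by rewrite -{1}[D]genP !principal_le mem_preimage. Qed.

(** Since [rD <= E] iff [D] lies in the preimage of [E], this is a Moebius sum over an interval. *)
Lemma pushed_mobius_sum r K E :
  \sum_(D | (D <= E)%O) pushed_mobius r K D =
  (K == preimage_right_ideal r E)%:R.
Proof.
rewrite -mobius_sumE.
rewrite [RHS](partition_big (fun D => pr (r * gen D)) (fun D => (D <= E)%O)).
  apply: eq_bigr => D leDE; apply: eq_bigl => F; rewrite le_preimage -andbA.
  by congr (_ && _); case: eqP => [->|_]; rewrite ?leDE ?andbF.
by move=> D /andP[_]; rewrite le_preimage.
Qed.

Lemma right_annihilator_le_preimage r E :
  (rann r <= preimage_right_ideal r E)%O.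
Proof.
apply/subsetP => s; rewrite mem_right_annihilator mem_preimage => /eqP->.
exact: in_right_ideal0.
Qed.

(** Every preimage contains [rann r], so none equals [K] and all down-set sums vanish. *)
Lemma pushed_mobius_out r K E : ~~ (rann r <= K)%O -> pushed_mobius r K E = 0.
Proof.
move=> nle; rewrite (@sum_le_inj _ _ _ (pushed_mobius r K) (fun=> 0)) // => F.
rewrite pushed_mobius_sum big1 // -[RHS]/(false%:R); congr (nat_of_bool _)%:R.
by apply: contraNF nle => /eqP->; apply: right_annihilator_le_preimage.
Qed.

(** The preimage of [E] is [rann r] iff [E] meets [rR] trivially, so both sides have the same
    down-set sums. *)
Lemma pushed_mobius_in r E :
  pushed_mobius r (rann r) E =
  if (E <= pr r)%O then mobius (zero_right_ideal R) E else 0.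
Proof.
pose F E := if (E <= pr r)%O then mobius (zero_right_ideal R) E else 0.
rewrite (@sum_le_inj _ _ _ (pushed_mobius r (rann r)) F) // => {}E.
rewrite pushed_mobius_sum -big_mkcondr.
rewrite (eq_bigl (fun D => (zero_right_ideal R <= D)%O
                           && (D <= cap_right_ideal E (pr r))%O)); last first.
  by move=> D; rewrite zero_ideal_le /= !right_ideal_leE subsetI.
rewrite mobius_sumE; congr (nat_of_bool _)%:R; apply/eqP/eqP => [eqr|eq0].
  apply: right_idealP => x; rewrite mem_zero_ideal mem_cap.
  apply/eqP/andP => [->|[Ex /mem_principalP[s xE]]];
    first by rewrite !in_right_ideal0.
  have : s \in rann r by rewrite eqr mem_preimage -xE.
  by rewrite mem_right_annihilator -xE => /eqP.
apply: right_idealP => s; rewrite [LHS]mem_right_annihilator mem_preimage.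
rewrite -mem_zero_ideal eq0 mem_cap andbC.
by have -> : r * s \in pr r by apply/mem_principalP; exists s.
Qed.

(** The entry at [r] and [K] of the matrix [w (r * d)] multiplied by the Moebius matrix. *)
Definition mobius_transform K r : rat :=
  \sum_(D | (K <= D)%O) w (r * gen D) * (mobius K D)%:~R.

Lemma mobius_transformE K r :
  mobius_transform K r = \sum_D w (gen D) * (pushed_mobius r K D)%:~R.
Proof.
rewrite /mobius_transform (partition_big (fun D => pr (r * gen D)) predT) //=.
apply: eq_bigr => D _; rewrite rmorph_sum /= mulr_sumr; apply: eq_bigr => F.
by case/andP=> _ /eqP <-; rewrite weight_gen.
Qed.

Lemma mobius_transform_out K r : ~~ (rann r <= K)%O -> mobius_transform K r = 0.
Proof.
move=> nle; rewrite mobius_transformE big1 // => D _.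
by rewrite pushed_mobius_out ?mulr0.
Qed.

Definition ideal_sum a : rat :=
  \sum_(D | (D != zero_right_ideal R) && (D <= pr a)%O)
    w (gen D) * (mobius (zero_right_ideal R) D)%:~R.

Lemma weight_gen0 : w (gen (zero_right_ideal R)) = 0.
Proof. by rewrite weight_gen. Qed.

Lemma mobius_transform_in r : mobius_transform (rann r) r = ideal_sum r.
Proof.
rewrite mobius_transformE /ideal_sum big_mkcondl /= [RHS]big_mkcond /=.
apply: eq_bigr => D _; rewrite pushed_mobius_in.
case: (D <= pr r)%O; last by rewrite mulr0.
by case: eqP => //= ->; rewrite weight_gen0 mul0r.
Qed.

Lemma mobius_transform_unit K u r :
  u \in unit_set R -> mobius_transform K (u * r) = mobius_transform K r.
Proof.
move=> Uu; apply: eq_bigr => D _.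
by rewrite -mulrA (wbi _ Uu).1.
Qed.

Lemma sum_mobius_transform (b : right_ideal R -> rat) r :
  \sum_D (\sum_(K | (K <= D)%O) b K * (mobius K D)%:~R) * w (r * gen D) =
  \sum_K b K * mobius_transform K r.
Proof.
under eq_bigr => D _ do rewrite mulr_suml.
rewrite (exchange_big_dep predT) //=; apply: eq_bigr => K _.
rewrite mulr_sumr; apply: eq_bigr => D _.
by rewrite -mulrA [_ * w _]mulrC.
Qed.

(** The partial sums [b] of [c] vanish, by induction from larger ideals: if [K = rann a], the
    equation at [a] involves only [b E] with [K <= E], and [b K] has coefficient [ideal_sum a]. *)
Lemma ideal_sum_unique (c : right_ideal R -> rat) :
    (forall a, a != 0 -> ideal_sum a != 0) -> \sum_D c D = 0 ->
    (forall r, \sum_D c D * w (r * gen D) = 0) ->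
  forall D, c D = 0.
Proof.
move=> nzS c_sum cw; pose b E := \sum_(D | (D <= E)%O) c D.
have cE : c =1 fun D => \sum_(K | (K <= D)%O) b K * (mobius K D)%:~R.
  by apply: sum_le_inj => E; rewrite mobius_transform_sum.
have b0 K : b K = 0.
  elim/gt_ind: K => K IHK; have [a aK] := right_annihilator_surj pirR K.
  (* [a = 0] means [K = R], where [b K] is the total sum of [c]. *)
  have [a0|nza] := eqVneq a 0.
    rewrite /b (eq_bigl predT) // => D.
    rewrite -aK a0; apply/subsetP => s _.
    by rewrite mem_right_annihilator mul0r.
  have := cw a; under eq_bigr => D _ do rewrite cE.
  rewrite sum_mobius_transform (bigD1 K) //= big1 ?addr0 => [|E neEK].
    rewrite -{2}aK mobius_transform_in => /eqP.
    by rewrite mulf_eq0 (negPf (nzS _ nza)) orbF => /eqP.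
  have [leKE|] := boolP (K <= E)%O; last first.
    by rewrite -aK => /mobius_transform_out->; rewrite mulr0.
  by rewrite IHK ?mul0r // lt_neqAle eq_sym neEK.
by move=> D; rewrite cE big1 // => K _; rewrite b0 mul0r.
Qed.

(* The matrix M is the Moebius transform on the columns below the annihilator
   of a0 and the identity elsewhere: its row at that annihilator is zero, and
   its kernel lives below it. *)
Lemma ideal_sum_dependent a0 :
    a0 != 0 -> ideal_sum a0 = 0 ->
  exists c : right_ideal R -> rat,
    [/\ exists D, c D != 0, \sum_D c D = 0
      & forall r, \sum_D c D * w (r * gen D) = 0].
Proof.
move=> nza0 S0; pose K0 := rann a0.
have exr K : exists a, rann a == K.
  by have [a <-] := right_annihilator_surj pirR K; exists a.
(* One row per right ideal suffices: the transform at [r] depends only on [rann r]. *)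
pose al K := xchoose (exr K).
have alE K : rann (al K) = K by apply/eqP/(xchooseP (exr K)).
have al_unit r : exists2 u, u \in unit_set R & al (rann r) = u * r.
  by apply: right_annihilator_unit; rewrite ?alE.
have alrE K r : mobius_transform K (al (rann r)) = mobius_transform K r.
  by have [u Uu ->] := al_unit r; rewrite mobius_transform_unit.
pose n := #|{: right_ideal R}|.
pose M K L : rat :=
  if (L <= K0)%O then mobius_transform L (al K) else (K == L)%:R.
have M0 L : M K0 L = 0.
  rewrite /M; case: ifP => [leL0|nle]; last first.
    by case: eqP nle => // <-; rewrite lexx.
  have [eqL|neL] := eqVneq L K0; first by rewrite eqL alrE mobius_transform_in.
  by rewrite mobius_transform_out // alE; apply: contra neL => ?;
    rewrite eq_le leL0.
pose A := \matrix_(i < n, j < n) M (enum_val i) (enum_val j).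
(* The zero row of [A] at [K0] makes it singular; transposing turns this into a column dependency
   [v]. *)
have /det0P[v nzv vA] : \det A^T == 0.
  rewrite det_tr; apply/det0P; exists (delta_mx 0 (enum_rank K0)).
    by apply/eqP => /rowP/(_ (enum_rank K0))/eqP; rewrite !mxE !eqxx oner_eq0.
  by rewrite -rowE; apply/rowP => j; rewrite !mxE enum_rankK M0.
pose b K : rat := v 0 (enum_rank K).
have Mb K : \sum_L b L * M K L = 0.
  have /rowP/(_ (enum_rank K)) := vA; rewrite !mxE => vM.
  rewrite (reindex (fun i : 'I_n => enum_val i)) /=; last first.
    by apply: onW_bij; exists enum_rank; [exact: enum_valK | exact: enum_rankK].
  rewrite -[RHS]vM; apply: eq_bigr => i _.
  by rewrite /b !mxE enum_rankK enum_valK.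
(* In row [K] a column [L <= K0] could be nonzero only if [K <= L], which would force [K <= K0]; the
   equation reduces to [b K = 0]. *)
have bout K : ~~ (K <= K0)%O -> b K = 0.
  move=> nle; have := Mb K; rewrite (bigD1 K) //= big1 => [|L neL].
    by rewrite /M (negPf nle) eqxx mulr1 addr0.
  rewrite /M; case: ifP => leL; last by rewrite eq_sym (negPf neL) mulr0.
  rewrite mobius_transform_out ?mulr0 // alE.
  by apply: contra nle => /le_trans; apply.
exists (fun D => \sum_(K | (K <= D)%O) b K * (mobius K D)%:~R); split.
- apply/existsP; apply: contraNT nzv => /existsPn b0; apply/eqP/rowP => i.
  rewrite mxE -[i]enum_valK -/(b _) -(mobius_transform_sum b) big1 // => D _.
  by apply/eqP; have := b0 D; rewrite negbK.
(* The total is [b] at the whole ring, which is not below [K0] because [a0 != 0]. *)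
- rewrite (eq_bigl (fun D => D <= pr 1)%O) => [|D];
    last by rewrite principal1_top.
  rewrite mobius_transform_sum bout //; rewrite principal_le.
  by rewrite mem_right_annihilator mulr1.
move=> r; rewrite sum_mobius_transform -[RHS](Mb (rann r));
  apply: eq_bigr => K _.
rewrite /M; case: ifP => [_|/negbT/bout->]; first by rewrite alrE.
by rewrite !mul0r.
Qed.

End MobiusTransform.

(** * Extension of isometries *)

Section UnitSet.
Variable R : finPzRingType.
Implicit Types (u v : R).

Lemma unit_set1 : 1 \in unit_set R.
Proof. by rewrite inE; apply/existsP; exists 1; rewrite mulr1 eqxx. Qed.

Lemma unit_setP u :
  reflect (exists2 v, v \in unit_set R & v * u = 1 /\ u * v = 1)
          (u \in unit_set R).
Proof.
apply: (iffP idP) => [|[v _ [vu uv]]]; rewrite inE.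
  case/existsP=> v /andP[/eqP vu /eqP uv]; exists v => //.
  by rewrite inE; apply/existsP; exists u; rewrite vu uv !eqxx.
by apply/existsP; exists v; rewrite vu uv !eqxx.
Qed.

Lemma unit_setM u v :
  u \in unit_set R -> v \in unit_set R -> u * v \in unit_set R.
Proof.
move=> /unit_setP[u' Uu' [u'u uu']] /unit_setP[v' Uv' [v'v vv']].
rewrite inE; apply/existsP; exists (v' * u').
by rewrite -mulrA (mulrA u') u'u mul1r v'v -mulrA (mulrA v) vv' mul1r uu' !eqxx.
Qed.

Lemma sum_unit_set (V : nmodType) (F : R -> V) v : v \in unit_set R ->
  \sum_(u in unit_set R) F (v * u) = \sum_(u in unit_set R) F u.
Proof.
move=> Uv; have [v' Uv' [v'v vv']] := unit_setP _ Uv.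
have inj_v : injective ( *%R v) by apply: (can_inj (g := *%R v')) => u;
  rewrite mulrA v'v mul1r.
rewrite [RHS](reindex_inj inj_v) /=; apply: eq_bigl => u.
apply/idP/idP => [|Uvu]; first exact: unit_setM.
by rewrite -[u]mul1r -v'v -mulrA unit_setM.
Qed.

End UnitSet.

(** * Counting coordinates by the right ideal they generate *)

Section IdealCounts.
Variables (R : finPzRingType) (w : R -> rat) (gen : right_ideal R -> R).
Hypotheses (pirR : principal_ring R) (wbi : bi_invariant w) (w0 : w 0 = 0).
Hypothesis genP : generator_choice gen.
Implicit Types (a r s u : R) (D E K : right_ideal R).
Local Notation pr := (@principal_right_ideal R).

Definition ideal_count n (x : 'I_n -> R) D : rat := \sum_(i | pr (x i) == D) 1.

Lemma sum_ideal_count n (x : 'I_n -> R) (h : right_ideal R -> rat) :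
  \sum_D ideal_count x D * h D = \sum_i h (pr (x i)).
Proof.
rewrite [RHS](partition_big (fun i => pr (x i)) predT) //=.
apply: eq_bigr => D _; rewrite mulr_suml; apply: eq_bigr => i /eqP->.
by rewrite mul1r.
Qed.

Lemma weight_mul_gen r a : w (r * gen (pr a)) = w (r * a).
Proof.
have [u Uu {2}->] := principal_unit (genP (pr a)).
by rewrite mulrA (wbi _ Uu).2.
Qed.

(** The difference of the counts solves the equations of [ideal_sum_unique]; its total is
    [n - n = 0]. *)
Lemma ideal_count_eq n (x y : 'I_n -> R) :
    (forall a, a != 0 -> ideal_sum w gen a != 0) ->
    (forall r, \sum_i w (r * x i) = \sum_i w (r * y i)) ->
  ideal_count x =1 ideal_count y.
Proof.
move=> nzS eqw D; apply/eqP; rewrite -subr_eq0; apply/eqP; move: D.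
apply: (ideal_sum_unique pirR wbi w0 genP nzS) => [|r].
  rewrite sumrB; under eq_bigr do rewrite -[ideal_count _ _]mulr1.
  under [X in _ - X]eq_bigr do rewrite -[ideal_count _ _]mulr1.
  by rewrite !(sum_ideal_count _ (fun=> 1)) subrr.
under eq_bigr do rewrite mulrBl; rewrite sumrB.
rewrite !(sum_ideal_count _ (fun D => w (r * gen D))).
by under eq_bigr do rewrite weight_mul_gen;
   under [X in _ - X]eq_bigr do rewrite weight_mul_gen; rewrite eqw subrr.
Qed.

(** [h] depends only on the right ideal its argument generates, so the counts determine the sum. *)
Lemma sum_invariant_eq n (x y : 'I_n -> R) (h : R -> rat) :
    (forall a, a != 0 -> ideal_sum w gen a != 0) ->
    (forall r, \sum_i w (r * x i) = \sum_i w (r * y i)) ->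
    (forall a u, u \in unit_set R -> h (a * u) = h a) ->
  \sum_i h (x i) = \sum_i h (y i).
Proof.
move=> nzS eqw hU.
have hgen a : h a = h (gen (pr a)).
  by have [u Uu {1}->] := principal_unit (genP (pr a)); apply: hU.
rewrite (eq_bigr _ (fun i _ => hgen (x i))) (eq_bigr _ (fun i _ => hgen (y i))).
rewrite -!(sum_ideal_count _ (fun D => h (gen D))).
by apply: eq_bigr => D _; rewrite (ideal_count_eq nzS eqw).
Qed.

End IdealCounts.

(** * Left linear functionals on a code *)

Section Functionals.
Variables (R : finPzRingType) (n : nat) (C : {set 'rV[R]_n}).
Hypothesis Csub : submod_closed C.
Implicit Types (g h nu : 'rV[R]_n -> R) (u v : R).

Definition functional_on g : Prop :=
  forall a, {in C &, forall x y, g (a *: x + y) = a * g x + g y}.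

Definition agree_on g h := [forall x in C, g x == h x].

Lemma submod0 : 0 \in C. Proof. by case: Csub. Qed.

Lemma submodB : {in C &, forall x y, x - y \in C}.
Proof.
by move=> x y Cx Cy; rewrite addrC -(scaleN1r y); case: Csub => _; apply.
Qed.

Lemma functionalB g :
  functional_on g -> {in C &, forall x y, g (x - y) = g x - g y}.
Proof.
move=> lg x y Cx Cy.
by rewrite [x - y]addrC -(scaleN1r y) lg // mulN1r addrC.
Qed.

Lemma functional_sub g h :
  functional_on g -> functional_on h -> functional_on (fun x => g x - h x).
Proof.
move=> lg lh a x y Cx Cy; rewrite lg // lh // mulrBr.
by rewrite opprD addrACA.
Qed.

Lemma functional_mulr g u : functional_on g -> functional_on (fun x => g x * u).
Proof. by move=> lg a x y Cx Cy; rewrite lg // mulrDl mulrA. Qed.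

(** Orthogonality with [k] in place of a character: the image of [g] is a left ideal, each of whose
    elements is taken equally often. *)
Lemma sum_functional (k : R -> rat) g :
    k 0 = 1 ->
    (forall L : {set R}, is_left_ideal L -> L != [set 0] ->
       \sum_(y in L) k y = 0) ->
    functional_on g ->
  \sum_(x in C) k (g x) = #|C|%:R * (agree_on g (fun=> 0))%:R.
Proof.
move=> k0 ksum lg; have gB := functionalB lg.
have g0 : g 0 = 0 by have := gB 0 0 submod0 submod0; rewrite !subrr.
rewrite (sum_additive submod0 submodB gB).
have [/forall_inP gC0|ngC0] := boolP (agree_on g (fun=> 0)).
  rewrite mulr1 (_ : [set x in C | g x == 0] = C); last first.
    by apply/setP => x; rewrite inE; case: (boolP (x \in C)) => // /gC0 ->.
  rewrite (_ : g @: C = [set 0]) ?big_set1 ?k0 ?mulr1 //.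
  apply/setP => y; rewrite inE; apply/imsetP/eqP => [[x /gC0/eqP ? ->] //|->].
  by exists 0; rewrite ?submod0.
rewrite mulr0 ksum ?mulr0 //.
  apply/and3P; split; first by apply/imsetP; exists 0; rewrite ?submod0.
    apply/forall_inP => _ /imsetP[x Cx ->];
      apply/forall_inP => _ /imsetP[y Cy ->].
    apply/imsetP; exists (1 *: x + y); first by case: Csub => _; apply.
    by rewrite lg // mul1r.
  apply/forall_inP => _ /imsetP[x Cx ->]; apply/forallP => r.
  apply/imsetP; exists (r *: x + 0); last by rewrite lg ?submod0 // g0 addr0.
  by case: Csub => C0; apply.
apply: contra ngC0 => /eqP gC0; apply/forall_inP => x Cx.
by rewrite -in_set1 -gC0; apply: imset_f.
Qed.

(** The orbit of [g] under right multiplication by units; values outside [C] are set to [0] so that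
    functionals agreeing on [C] coincide. *)
Definition functional_class g : {set {ffun 'rV[R]_n -> R}} :=
  [set [ffun x => if x \in C then g x * u else 0] | u in unit_set R].

Lemma functional_class_eq g h v :
  v \in unit_set R -> agree_on (fun x => g x * v) h ->
  functional_class g = functional_class h.
Proof.
move=> Uv /forall_inP gh; have [v' Uv' [v'v vv']] := unit_setP _ Uv.
apply/setP => t; apply/imsetP/imsetP => -[u Uu ->].
  exists (v' * u); first exact: unit_setM.
  apply/ffunP => x; rewrite !ffunE; case: ifP => // Cx.
  by rewrite -(eqP (gh x Cx)) -mulrA (mulrA v) vv' mul1r.
exists (v * u); first exact: unit_setM.
apply/ffunP => x; rewrite !ffunE; case: ifP => // Cx.
by rewrite -(eqP (gh x Cx)) mulrA.
Qed.

Lemma functional_classP g h : functional_class g = functional_class h ->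
  exists2 u, u \in unit_set R & agree_on (fun x => g x * u) h.
Proof.
move=> eqgh; have : [ffun x => if x \in C then h x * 1 else 0] \in
  functional_class g.
  by rewrite eqgh; apply/imsetP; exists 1; rewrite ?unit_set1.
case/imsetP=> u Uu /ffunP eqh; exists u => //; apply/forall_inP => x Cx.
by have := eqh x; rewrite !ffunE Cx mulr1 => ->.
Qed.

(** If [h = g v] on [C], the units carrying [g] to [h] form a translate by [v] of the stabilizer of
    [h]. *)
Lemma sum_agree_class g h :
  \sum_(u in unit_set R) (agree_on (fun x => g x * u) h : nat) =
  ((functional_class g == functional_class h) *
   \sum_(u in unit_set R) agree_on (fun x => (h x * u)%R) h)%N.
Proof.
case: eqP => [/functional_classP[v Uv gvh]|neq]; last first.
  rewrite mul0n big1 // => u Uu.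
  by case: (boolP (agree_on _ h)) => // /(functional_class_eq Uu)/neq.
rewrite mul1n -(sum_unit_set _ Uv); apply: eq_bigr => u _;
  congr (nat_of_bool _).
apply: eq_forallb_in => x Cx; have /forall_inP/(_ x Cx)/eqP <- := gvh.
by rewrite mulrA.
Qed.

Lemma sum_agree_gt0 h :
  (0 < \sum_(u in unit_set R) agree_on (fun x => (h x * u)%R) h)%N.
Proof.
rewrite (bigD1 1) ?unit_set1 //= ltn_addr // lt0b.
by apply/forall_inP => x _; rewrite mulr1.
Qed.

End Functionals.

(** * Isometries are monomial when no sum vanishes *)

Section Sufficiency.
Variables (R : finPzRingType) (w : R -> rat) (gen : right_ideal R -> R).
Hypotheses (pirR : principal_ring R) (wbi : bi_invariant w) (w0 : w 0 = 0).
Hypothesis genP : generator_choice gen.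
Hypothesis nzS : forall a, a != 0 -> ideal_sum w gen a != 0.

Section Isometry.
Variables (n : nat) (C : {set 'rV[R]_n}) (f : 'rV[R]_n -> 'rV[R]_n).
Hypotheses (Csub : submod_closed C) (isof : isometry_on w C f).

Lemma functional_coord i : functional_on C (fun x => x 0 i).
Proof. by move=> a x y _ _; rewrite !mxE. Qed.

Lemma functional_isometry i : functional_on C (fun x => f x 0 i).
Proof. by move=> a x y Cx Cy; case: isof => lf _; rewrite lf // !mxE. Qed.

Lemma isometry_scale x r : x \in C ->
  \sum_i w (r * x 0 i) = \sum_i w (r * f x 0 i).
Proof.
move=> Cx; have [lf wf] := isof; have C0 := submod0 Csub.
have f0 : f 0 = 0.
  have := lf 1 0 0 C0 C0; rewrite !scale1r addr0 => /eqP.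
  by rewrite -subr_eq subrr eq_sym => /eqP.
have Crx : r *: x + 0 \in C by case: Csub => _; apply.
have := wf _ Crx; rewrite lf // f0 !addr0 /weight => eqw.
have wE (y : 'rV[R]_n) : \sum_i w (r * y 0 i) = weight w (r *: y).
  by apply: eq_bigr => i _; rewrite mxE.
by rewrite !wE.
Qed.

(** The sum of [k (l x * u - nu x)] over codewords [x], coordinates [l] and units [u] is evaluated
    in two orders: for fixed [x], [sum_invariant_eq] equates the contributions of [x] and [f x]; for
    fixed [l] and [u], [sum_functional] detects agreement with [nu]. *)
Lemma isometry_agree nu : functional_on C nu ->
  (\sum_(i < n) \sum_(u in unit_set R) agree_on C (fun x => (x 0 i * u)%R) nu =
   \sum_(i < n) \sum_(u in unit_set R)
     agree_on C (fun x => (f x 0 i * u)%R) nu)%N.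
Proof.
move=> lnu; have [k k0 ksum] := sum_zero_function_left pirR.
have agreeE (g : 'I_n -> 'rV[R]_n -> R) : (forall i, functional_on C (g i)) ->
    \sum_(x in C) \sum_i \sum_(u in unit_set R) k (g i x * u - nu x) =
    #|C|%:R * (\sum_(i < n) \sum_(u in unit_set R)
                agree_on C (fun x => (g i x * u)%R) nu)%:R.
  move=> lg; rewrite exchange_big natr_sum mulr_sumr; apply: eq_bigr => i _ /=.
  rewrite exchange_big natr_sum mulr_sumr; apply: eq_bigr => u _ /=.
  rewrite (sum_functional Csub k0 ksum); last first.
    apply: (functional_sub (g := fun x => g i x * u)) lnu.
    exact: functional_mulr.
  congr (_ * (nat_of_bool _)%:R); apply: eq_forallb_in => x _.
  by rewrite subr_eq0.
have C0 : #|C|%:R != 0 :> rat.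
  by rewrite pnatr_eq0 -lt0n; apply/card_gt0P; exists 0; apply: submod0.
apply/eqP; rewrite -(eqr_nat rat); apply/eqP/(mulfI C0).
rewrite -(agreeE (fun i x => x 0 i)); last exact: functional_coord.
rewrite -(agreeE (fun i x => f x 0 i)); last exact: functional_isometry.
apply: eq_bigr => x Cx.
(* Summing over all units makes [h] invariant under right multiplication by units. *)
pose h y := \sum_(u in unit_set R) k (y * u - nu x).
apply: (@sum_invariant_eq _ _ _ pirR wbi w0 genP _
          (fun i => x 0 i) (fun i => f x 0 i) h nzS).
  by move=> r; apply: isometry_scale.
move=> a u Uu; rewrite /h -[RHS](sum_unit_set _ Uu).
by apply: eq_bigr => v _; rewrite mulrA.
Qed.

(** Both agreement counts are divided by the size of the stabilizer of [nu], which is positive. *)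
Lemma isometry_count nu : functional_on C nu ->
  count_mem (functional_class C nu)
    [tuple functional_class C (fun x => f x 0 i) | i < n] =
  count_mem (functional_class C nu)
    [tuple functional_class C (fun x => x 0 i) | i < n].
Proof.
move=> lnu; have := isometry_agree lnu.
have countE (g : 'I_n -> 'rV[R]_n -> R) :
    (\sum_i \sum_(u in unit_set R) agree_on C (fun x => (g i x * u)%R) nu =
     count_mem (functional_class C nu) [tuple functional_class C (g i) | i < n] *
     \sum_(u in unit_set R) agree_on C (fun x => (nu x * u)%R) nu)%N.
  rewrite -sum1_count big_map val_ord_tuple big_enum_cond /=.
  rewrite [X in (X * _)%N]big_mkcond big_distrl /=; apply: eq_bigr => i _.
  by rewrite sum_agree_class; case: eqP.
rewrite (countE (fun i x => x 0 i)) (countE (fun i x => f x 0 i)) => /eqP.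
by rewrite eqn_pmul2r ?sum_agree_gt0 // => /eqP.
Qed.

(** Matching equal multisets of classes gives the permutation; equality of matched classes gives the
    units. *)
Lemma isometry_monomial : exists (p : 'S_n) (u : 'I_n -> R),
  (forall i, u i \in right_symmetry_group w) /\ {in C, f =1 monomial_map p u}.
Proof.
have /tuple_permP[p fE] : perm_eq
    [tuple functional_class C (fun x => f x 0 i) | i < n]
    [tuple functional_class C (fun x => x 0 i) | i < n].
  apply/allP => t; rewrite mem_cat /=.
  by case/orP=> /mapP[i _ ->]; rewrite isometry_count //;
     [apply: functional_isometry | apply: functional_coord].
have /fin_all_exists2[u Uu fu] i : exists2 u, u \in unit_set R &
    agree_on C (fun x => x 0 (p i) * u) (fun x => f x 0 i).
  apply: functional_classP.
  have := congr1 (fun t => nth set0 t i) fE.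
  by rewrite -!tnth_nth !tnth_mktuple.
exists p, u; split=> [i|x Cx].
  rewrite inE Uu; apply/forallP => x; apply/eqP.
  by case: (wbi x (Uu i)).
apply/rowP => i; rewrite mxE; have /forall_inP/(_ x Cx)/eqP-> // := fu i.
Qed.

End Isometry.

Lemma extension_property_holds : extension_property w.
Proof. by move=> n C f _ Csub isof _; apply: isometry_monomial. Qed.

End Sufficiency.

(** * Non-extendable isometries *)

(** [N] is the product of the denominators, and each integer [c t * N] is split into positive and
    negative parts. *)
Lemma clear_denominators (T : finType) (c : T -> rat) :
  exists (N : nat) (a b : T -> nat), (0 < N)%N /\
    forall t, c t * N%:R = (a t)%:R - (b t)%:R.
Proof.
pose N := (\prod_t `|denq (c t)|)%N; exists N.
have /fin_all_exists[ab abE] t :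
    exists ab : nat * nat, c t * N%:R = ab.1%:R - ab.2%:R.
  have [m ->] : exists m : int, c t * N%:R = m%:~R.
    exists (numq (c t) * (\prod_(s | s != t) `|denq (c s)|)%N%:Z).
    rewrite /N (bigD1 t) //= natrM mulrA rmorphM /=; congr (_ * _).
    by rewrite natr_absz ger0_norm ?denq_ge0 // numqE.
  case: m => m; first by exists (m, 0%N); rewrite subr0.
  by exists (0%N, m.+1); rewrite NegzE mulrNz sub0r.
exists (fun t => (ab t).1), (fun t => (ab t).2); split=> //.
by rewrite prodn_gt0 // => t; rewrite absz_gt0 denq_neq0.
Qed.

Section Necessity.
Variables (R : finPzRingType) (w : R -> rat) (gen : right_ideal R -> R).
Hypotheses (pirR : principal_ring R) (wbi : bi_invariant w).
Hypothesis genP : generator_choice gen.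
Hypothesis extw : extension_property w.
Local Notation pr := (@principal_right_ideal R).

Definition generator_seq (c : right_ideal R -> nat) : seq R :=
  flatten [seq nseq (c D) (gen D) | D <- enum {: right_ideal R}].

Lemma sum_generator_seq (c : right_ideal R -> nat) (h : R -> rat) :
  \sum_(z <- generator_seq c) h z = \sum_D (c D)%:R * h (gen D).
Proof.
rewrite big_flatten big_map big_enum /=; apply: eq_bigr => D _.
by rewrite big_nseq iter_addr addr0 mulr_natl.
Qed.

(** The leading [1] lets [r] be read off [r *: x], so that [r *: x |-> r *: y] is well defined and
    injective. *)
Definition code_word n (s : seq R) : 'rV[R]_n.+1 := \row_i nth 0 (1 :: s) i.

Lemma sum_code_word n (s : seq R) (h : R -> rat) : size s = n ->
  \sum_(i < n.+1) h (code_word n s 0 i) = h 1 + \sum_(z <- s) h z.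
Proof.
have -> : h 1 + \sum_(z <- s) h z = \sum_(z <- 1 :: s) h z by rewrite big_cons.
move=> <-; rewrite [RHS](big_nth 0) big_mkord.
by apply: eq_bigr => i _; rewrite mxE.
Qed.

(** The positive and negative parts of an integral dependency give words [x] and [y]; the dependency
    says that [r *: x] and [r *: y] have equal weight, and monomiality forces the two parts to
    coincide. *)
Lemma extension_ideal_independent (c : right_ideal R -> rat) :
    \sum_D c D = 0 -> (forall r, \sum_D c D * w (r * gen D) = 0) ->
  forall D, c D = 0.
Proof.
move=> c_sum cw; have [N [a [b [N0 cE]]]] := clear_denominators c.
have sumE (h : R -> rat) : (\sum_D c D * h (gen D)) * N%:R =
    \sum_D (a D)%:R * h (gen D) - \sum_D (b D)%:R * h (gen D).
  rewrite mulr_suml -sumrB; apply: eq_bigr => D _.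
  by rewrite mulrAC cE mulrBl.
(* Equal lengths come from the vanishing total of [c]. *)
have size_ab : size (generator_seq a) = size (generator_seq b).
  apply/eqP; rewrite -(eqr_nat rat) -subr_eq0.
  have sizeE (d : right_ideal R -> nat) :
      (size (generator_seq d))%:R = \sum_D (d D)%:R * 1 :> rat.
    rewrite -(sum_generator_seq d (fun=> 1)) big_const_seq count_predT.
    by rewrite iter_addr addr0.
  rewrite !sizeE -(sumE (fun=> 1)); under eq_bigr do rewrite mulr1.
  by rewrite c_sum mul0r.
pose n := size (generator_seq b).
pose x := code_word n (generator_seq a).
pose y := code_word n (generator_seq b).
pose C := [set r *: x | r : R].
pose f (v : 'rV[R]_n.+1) := v 0 ord0 *: y.
have x0 : x 0 ord0 = 1 by rewrite mxE.
have y0 : y 0 ord0 = 1 by rewrite mxE.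
have fx r : f (r *: x) = r *: y by rewrite /f mxE x0 mulr1.
have Csub : submod_closed C.
  split; first by apply/imsetP; exists 0; rewrite ?scale0r.
  move=> r _ _ /imsetP[s _ ->] /imsetP[t _ ->]; apply/imsetP;
    exists (r * s + t) => //.
  by rewrite scalerDl scalerA.
have isof : isometry_on w C f.
  split=> [r u v _ _|_ /imsetP[r _ ->]].
    by rewrite /f !mxE scalerDl scalerA.
  have wE (d : right_ideal R -> nat) : size (generator_seq d) = n ->
      weight w (r *: code_word n (generator_seq d)) =
      w r + \sum_D (d D)%:R * w (r * gen D).
    move=> sd; rewrite -(sum_generator_seq d (fun z => w (r * z))).
    rewrite -[w r](congr1 w (mulr1 r)) -(sum_code_word (fun z => w (r * z)) sd).
    by apply: eq_bigr => i _; rewrite mxE.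
  rewrite fx /x /y !wE //; congr (_ + _); apply/eqP; rewrite eq_sym -subr_eq0.
  by rewrite -(sumE (fun z => w (r * z))) cw mul0r.
have injf : {in C &, injective f}.
  move=> _ _ /imsetP[r _ ->] /imsetP[s _ ->]; rewrite !fx.
  by move=> /rowP/(_ ord0); rewrite !mxE /= !mulr1 => ->.
have [p [u [Uu fE]]] := extw (isT : (1 <= n.+1)%N) Csub isof injf.
have yE i : pr (y 0 i) = pr (x 0 (p i)).
  have Cx : x \in C by apply/imsetP; exists 1; rewrite ?scale1r.
  have := fE _ Cx; rewrite -{1}[x]scale1r fx scale1r => ->.
  by rewrite mxE principal_mulr_unit //; have := Uu i; rewrite inE => /andP[].
(* Unit factors and permutations preserve the number of coordinates generating [D]. The leading [1]
   cancels, and what remains is [c D * N = 0]. *)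
move=> D; have : \sum_i (pr (y 0 i) == D)%:R =
    \sum_i (pr (x 0 i) == D)%:R :> rat.
  rewrite [RHS](reindex_inj (@perm_inj _ p)) /=.
  by apply: eq_bigr => i _; rewrite yE.
rewrite !(sum_code_word (fun z => (pr z == D)%:R)) // => /addrI.
rewrite !(sum_generator_seq _ (fun z => (pr z == D)%:R)) => /eqP.
rewrite eq_sym -subr_eq0 -(sumE (fun z => (pr z == D)%:R)).
rewrite mulf_eq0 pnatr_eq0 (gtn_eqF N0) orbF (bigD1 D) //= genP eqxx mulr1.
rewrite big1 ?addr0 => [/eqP //|E neE]; by rewrite genP (negPf neE) mulr0.
Qed.

End Necessity.

Theorem theorem4p4 (R : finPzRingType) (w : R -> rat)
    (gen : right_ideal R -> R) :
  principal_ring R -> bi_invariant w -> w 0 = 0 -> generator_choice gen ->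
  extension_property w <->
  (forall a : R, principal_right_ideal a != zero_right_ideal R ->
     \sum_(D : right_ideal R |
             (D != zero_right_ideal R) && (D <= principal_right_ideal a)%O)
        w (gen D) * (mobius (zero_right_ideal R) D)%:~R != 0).
Proof.
move=> pirR wbi w0 genP; split=> [extw a|nzS]; last first.
  apply: (extension_property_holds pirR wbi w0 genP) => a nza.
  by apply: nzS; rewrite principal_eq0.
rewrite principal_eq0 => nza; apply/eqP => S0.
have [c [[D nzD] c_sum cw]] := ideal_sum_dependent pirR wbi w0 genP nza S0.
by rewrite (extension_ideal_independent genP extw c_sum cw) eqxx in nzD.
Qed.
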